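(* Let $R$ be a complete discrete valuation ring with maximal ideal $\mathfrak{p}=pR$ and field of fractions $F$. Fix $n\ge1$, $\gamma=\begin{pmatrix}0&1\\ p^n&0\end{pmatrix}$, $\mathcal{O}=\begin{pmatrix}R&R\\ \mathfrak{p}^n&R\end{pmatrix}$, and let $\sigma\colon\mathcal{O}^\times\to\operatorname{Sym}(\operatorname{Id}(\mathcal{O};\mathfrak{p})')$, $\omega\mapsto\sigma_\omega$, with $\sigma_\omega(P)=P\omega$. Then \[\ker(\sigma)=\left\{\begin{pmatrix}a+k_1p&bp\\ cp^{n+1}&a+k_2p\end{pmatrix}:\ a\in R^\times,\ b,c,k_1,k_2\in R\right\}.\]
   Context: $\operatorname{Id}(\mathcal{O};\mathfrak{p})$ is the set of principal left ideals of $\mathcal{O}$ of reduced norm $\mathfrak{p}$ (reduced norm $=\det$), and $\operatorname{Id}(\mathcal{O};\mathfrak{p})'$ is $\operatorname{Id}(\mathcal{O};\mathfrak{p})$ with the Jacobson radical $\operatorname{rad}(\mathcal{O})$ removed when $n=1$, and all of $\operatorname{Id}(\mathcal{O};\mathfrak{p})$ when $n\ge2$. The kernel is $\{\omega\in\mathcal{O}^\times:\sigma_\omega=\mathrm{id}\}$. *)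

(* Defs.v *)
From HB Require Import structures.
From mathcomp Require Import all_boot all_order all_algebra.
From mathcomp Require Import boolp classical_sets.
Set Implicit Arguments.
Unset Strict Implicit.
Unset Printing Implicit Defensive.
Import GRing.Theory.
Local Open Scope classical_set_scope.
Local Open Scope ring_scope.

Notation "x %:F" := (@tofrac _ x) : ring_scope.

(* O is meant to be a subring (with 1) of the ambient ring A; for a
   commutative ring R one takes A := R and O := setT. *)
Section LeftIdeals.
Variable A : nzRingType.
Implicit Types O I P M : set A.

(* Closure under opposite follows from -1 being in O. *)
Definition left_ideal O I : Prop :=
  [/\ I `<=` O,
      I 0,
      forall x y, I x -> I y -> I (x + y)
    & forall a x, O a -> I x -> I (a * x)].

Definition left_multiples O (x : A) : set A := [set a * x | a in O].

Definition principal_left_ideal O P : Prop :=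
  exists2 x, O x & P = left_multiples O x.

Definition maximal_left_ideal O M : Prop :=
  [/\ left_ideal O M, M <> O
    & forall I, left_ideal O I -> M `<=` I -> I = M \/ I = O].

Definition jacobson_radical O : set A := \bigcap_(M in maximal_left_ideal O) M.

Definition units_of O : set A :=
  [set w | O w /\ exists2 w', O w' & w * w' = 1 /\ w' * w = 1].

Definition right_translate P (w : A) : set A := [set x * w | x in P].

End LeftIdeals.

Section ValuationRings.
Variable R : idomainType.

Definition ideal (I : set R) : Prop := left_ideal setT I.
Definition principal (x : R) : set R := left_multiples setT x.
Definition maximal_ideal (I : set R) : Prop := maximal_left_ideal setT I.

(* A local principal ideal domain that is not a field. *)
Definition discrete_valuation_ring : Prop :=
  (forall I, ideal I -> exists x, I = principal x) /\
  (exists M, [/\ maximal_ideal M, M <> [set 0]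
               & forall M', maximal_ideal M' -> M' = M]).

(* Every Cauchy sequence for the p-adic topology has a limit; separatedness is
   automatic in a discrete valuation ring with maximal ideal pR. *)
Definition adically_complete (p : R) : Prop :=
  forall u : nat -> R,
    (forall k, exists N, forall i j, (N <= i)%N -> (N <= j)%N ->
       principal (p ^+ k) (u i - u j)) ->
    exists l, forall k, exists N, forall i, (N <= i)%N ->
       principal (p ^+ k) (u i - l).

Definition submodule (N : set {fraction R}) : Prop :=
  [/\ N 0,
      forall x y, N x -> N y -> N (x + y)
    & forall (r : R) x, N x -> N (r%:F * x)].

Definition span (S : set {fraction R}) : set {fraction R} :=
  \bigcap_(N in [set N | submodule N /\ S `<=` N]) N.

(* The R-submodule of Frac(R) generated by the determinants of the elements of
   P; when P is O x this is R det(x). *)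
Definition reduced_norm (P : set 'M[{fraction R}]_2) : set {fraction R} :=
  span [set \det x | x in P].

Definition mx2 (T : Type) (a b c d : T) : 'M[T]_2 :=
  \matrix_(i, j) if i == 0 then if j == 0 then a else b
                 else if j == 0 then c else d.

Definition eichler_order (n : nat) (p : R) : set 'M[{fraction R}]_2 :=
  [set x | exists a b c d : R,
     x = mx2 a%:F b%:F (p ^+ n * c)%:F d%:F].

End ValuationRings.

Section Action.
Variables (R : idomainType) (n : nat) (p : R).
Let O := eichler_order n p.

Definition Id : set (set 'M[{fraction R}]_2) :=
  [set P | principal_left_ideal O P /\
           reduced_norm P = [set x%:F | x in principal p]].

Definition Id' : set (set 'M[{fraction R}]_2) :=
  if n == 1%N then Id `\ jacobson_radical O else Id.

End Action.

Section WellDefined.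
Variables (R : idomainType) (n : nat) (p : R).
Local Notation O := (eichler_order n p).

Lemma mx2M (T : comNzRingType) (a b c d a' b' c' d' : T) :
  mx2 a b c d * mx2 a' b' c' d' =
  mx2 (a * a' + b * c') (a * b' + b * d') (c * a' + d * c') (c * b' + d * d').
Proof.
apply/matrixP => i j; rewrite !mxE !big_ord_recl big_ord0 !mxE /= addr0.
by case: ifP; case: ifP.
Qed.

Lemma det_mx2 (T : comNzRingType) (a b c d : T) :
  \det (mx2 a b c d) = a * d - b * c.
Proof.
rewrite (expand_det_row _ 0) !big_ord_recl big_ord0 addr0 /cofactor !det_mx11.
by rewrite !mxE /= expr0 expr1 mul1r mulN1r mulrN.
Qed.

Lemma eichler_orderM x y : O x -> O y -> O (x * y).
Proof.
move=> [a [b [c [d ->]]]] [a' [b' [c' [d' ->]]]].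
exists (a * a' + b * (p ^+ n * c')), (a * b' + b * d').
exists (c * a' + d * c'), (p ^+ n * c * b' + d * d').
rewrite mx2M; congr mx2; rewrite -!rmorphM -rmorphD //; congr tofrac.
by rewrite mulrDr !mulrA; congr (_ + _); rewrite (mulrC d).
Qed.

Lemma eichler_order_det x : O x -> exists r : R, \det x = r%:F.
Proof.
move=> [a [b [c [d ->]]]]; exists (a * d - b * (p ^+ n * c)).
by rewrite det_mx2 -!rmorphM -rmorphB.
Qed.

Lemma units_of_inv w : units_of O w ->
  exists w', [/\ units_of O w', w * w' = 1 & w' * w = 1].
Proof.
by move=> [Ow [w' Ow' [h1 h2]]]; exists w'; split=> //; split=> //; exists w.
Qed.

Lemma right_translateK (P : set 'M[{fraction R}]_2) w w' :
  w * w' = 1 -> right_translate (right_translate P w) w' = P.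
Proof.
move=> h; rewrite /right_translate; apply/seteqP; split=> [x /= [_ [y Py <-] <-]|x Px /=].
  by rewrite -mulrA h mulr1.
by exists (x * w); [exists x | rewrite -mulrA h mulr1].
Qed.

Lemma right_translateS (P Q : set 'M[{fraction R}]_2) w :
  P `<=` Q -> right_translate P w `<=` right_translate Q w.
Proof. by move=> PQ _ [x Px <-]; exists x => //; apply: PQ. Qed.

Lemma left_ideal_translate I w : O w ->
  left_ideal O I -> left_ideal O (right_translate I w).
Proof.
move=> Ow [IO I0 ID IM]; split.
- by move=> _ [x Ix <-]; apply: eichler_orderM => //; apply: IO.
- by exists 0; rewrite ?mul0r.
- by move=> _ _ [x Ix <-] [y Iy <-]; exists (x + y); rewrite ?mulrDl //; apply: ID.
- by move=> a _ Oa [x Ix <-]; exists (a * x); rewrite ?mulrA //; apply: IM.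
Qed.

Lemma translate_order w : units_of O w -> right_translate O w = O.
Proof.
move=> Uw; have [Ow _] := Uw; have [w' [[Ow' _] h1 h2]] := units_of_inv Uw.
apply/seteqP; split=> [_ [x Ox <-]|x Ox]; first exact: eichler_orderM.
by exists (x * w'); [exact: eichler_orderM | rewrite -mulrA h2 mulr1].
Qed.

Lemma maximal_left_ideal_translate M w : units_of O w ->
  maximal_left_ideal O M -> maximal_left_ideal O (right_translate M w).
Proof.
move=> Uw [MO Mne Mmax]; have [Ow _] := Uw.
have [w' [Uw' h1 h2]] := units_of_inv Uw; have [Ow' _] := Uw'.
split; first exact: left_ideal_translate.
  move=> MwO; apply: Mne.
  by rewrite -(right_translateK M h1) MwO translate_order.
move=> I II MI.
have := Mmax _ (left_ideal_translate Ow' II).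
rewrite -{1}(right_translateK M h1) => /(_ (right_translateS MI)).
case=> e; [left|right]; rewrite -(right_translateK I h2) e //.
exact: translate_order.
Qed.

Lemma jacobson_radical_translate w : units_of O w ->
  right_translate (jacobson_radical O) w = jacobson_radical O.
Proof.
have sub v : units_of O v ->
    right_translate (jacobson_radical O) v `<=` jacobson_radical O.
  move=> Uv _ [x Jx <-] M MM; have [v' [Uv' h1 h2]] := units_of_inv Uv.
  have [y My <-] := Jx _ (maximal_left_ideal_translate Uv' MM).
  by rewrite -mulrA h2 mulr1.
move=> Uw; apply/seteqP; split; first exact: sub.
have [w' [Uw' h1 h2]] := units_of_inv Uw.
have := right_translateS (w := w) (sub _ Uw').
by rewrite right_translateK.
Qed.

Lemma reduced_norm_translate P w : units_of O w ->
  reduced_norm (right_translate P w) = reduced_norm P.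
Proof.
have sub Q v : units_of O v ->
    reduced_norm (right_translate Q v) `<=` reduced_norm Q.
  move=> [/eichler_order_det[r dv] _] x Hx N [[N0 ND NM] QN].
  apply: Hx; split=> // _ [_ [y Qy <-] <-].
  rewrite -[y * v]/(y *m v) det_mulmx dv mulrC; apply: NM.
  by apply: QN; exists y.
move=> Uw; apply/seteqP; split; first exact: sub.
have [w' [Uw' h1 h2]] := units_of_inv Uw.
by rewrite -{1}(right_translateK P h1); exact: sub.
Qed.

Lemma Id_translate P w : units_of O w -> Id n p P -> Id n p (right_translate P w).
Proof.
move=> Uw [[x Ox ->] nP]; split; last by rewrite reduced_norm_translate.
exists (x * w); first by apply: eichler_orderM => //; case: Uw.
apply/seteqP; split=> [_ [_ [a Oa <-] <-]|_ [a Oa <-]].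
  by exists a => //; rewrite mulrA.
by exists (a * x); [exists a | rewrite mulrA].
Qed.

Lemma Id'_translate P w : units_of O w -> P \in Id' n p ->
  right_translate P w \in Id' n p.
Proof.
move=> Uw; rewrite !inE /Id'; case: ifP => _; last exact: Id_translate.
move=> [IP neP]; split; first exact: Id_translate.
move=> /= e; apply: neP => /=.
have [w' [Uw' h1 h2]] := units_of_inv Uw.
by rewrite -(right_translateK P h1) e jacobson_radical_translate.
Qed.

End WellDefined.

Definition Sym (X : Type) : Type := {s : X -> X | bijective s}.

Section Sigma.
Variables (R : idomainType) (n : nat) (p : R).
Local Notation O := (eichler_order n p).

Definition sigma_fun (w : units_of O) (P : Id' n p) : Id' n p :=
  exist _ (right_translate (val P) (val w))
    (Id'_translate (set_mem (valP w)) (valP P)).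

Lemma sigma_fun_bij (w : units_of O) : bijective (sigma_fun w).
Proof.
have [w' [Uw' h1 h2]] := units_of_inv (set_mem (valP w)).
exists (sigma_fun (exist _ w' (mem_set Uw'))) => P;
  by apply: val_inj; rewrite /= right_translateK.
Qed.

Definition sigma (w : units_of O) : Sym (Id' n p) :=
  exist _ (sigma_fun w) (sigma_fun_bij w).

Definition ker_sigma : set 'M[{fraction R}]_2 :=
  [set val w | w in [set w : units_of O | sval (sigma w) = id]].

End Sigma.

(* Main.v *)
Require Import Defs.
From HB Require Import structures.
From mathcomp Require Import all_boot all_order all_algebra.
From mathcomp Require Import boolp classical_sets.
From mathcomp Require Import ring.
Set Implicit Arguments.
Unset Strict Implicit.
Import GRing.Theory.
Local Open Scope classical_set_scope.
Local Open Scope ring_scope.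

(** The matrices on the right-hand side are the [w = a + p m] with [a] a unit
of [R] and [m] in the order [O].  If [P = O x] has reduced norm [pR], then
[p = v det x] for some [v] in [R], so [x w = (a + v x m adj x) x] with [adj x]
in [O]; hence [P w] is contained in [P], and equality follows since [w^-1] has
the same shape.  Conversely, [w] in the kernel fixes the ideals generated by
[(1 b; 0 p)] for [b = 0, 1] and by [(p 0; 0 1)], none of which is the Jacobson
radical, and comparing entries in [x w = y x] gives the congruences mod [p]. *)

(** * Units and the maximal ideal of a discrete valuation ring *)

Section LocalRing.
Variable R : idomainType.
Implicit Types (r x p : R).

Lemma principalP x r : principal x r <-> exists t, r = t * x.
Proof.
by split=> [[t _ <-]|[t ->]]; exists t.
Qed.

Lemma ideal_principal x : ideal (principal x).
Proof.
split=> //.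
- by apply/principalP; exists 0; rewrite mul0r.
- move=> _ _ [s _ <-] [t _ <-]; apply/principalP; exists (s + t).
  by rewrite mulrDl.
- move=> a _ _ [s _ <-]; apply/principalP; exists (a * s).
  by rewrite mulrA.
Qed.

Lemma principal_id x : principal x x.
Proof. by apply/principalP; exists 1; rewrite mul1r. Qed.

Lemma ideal_with_one (I : set R) : ideal I -> I 1 -> I = setT.
Proof.
move=> [_ _ _ IM] I1; apply/seteqP; split=> // x _.
by rewrite -[x]mulr1; apply: IM.
Qed.

(** [discrete_valuation_ring] says that the maximal ideal is unique, but not that it contains every
    nonunit. Zorn is applied to the ideals that contain [r] but not [1]: an ideal strictly above a
    largest one contains [1], hence is everything. *)
Lemma nonunit_in_maximal_ideal r :
  r \isn't a GRing.unit -> exists2 M, maximal_ideal M & M r.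
Proof.
move=> rN.
(* The empty set is admitted only so that the empty chain has a bound. *)
pose Q (I : set R) := I = set0 \/ [/\ ideal I, I r & ~ I 1].
have Qr : Q (principal r).
  right; split; [exact: ideal_principal|exact: principal_id|].
  move=> /principalP[t /esym tr]; move/negP: rN; apply.
  by apply/unitrP; exists t; rewrite (mulrC r) tr.
have [|M [QM Mmax]] := @Zorn_bigcup R Q.
  move=> F FQ Ftot.
  have [[I0 [FI0 [x0 I0x0]]]|noI] := pselect (exists I, F I /\ I !=set0); last first.
    left; apply/seteqP; split=> // x [I FI Ix].
    by apply: noI; exists I; split=> //; exists x.
  have FI I x : F I -> I x -> [/\ ideal I, I r & ~ I 1].
    by move=> /FQ [->|//].
  right; split.
  - split=> //.
    + by exists I0 => //; have [[]] := FI _ _ FI0 I0x0.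
    + move=> x y [I fI Ix] [J fJ Jy].
      have [[_ _ ID _] _ _] := FI _ _ fI Ix.
      have [[_ _ JD _] _ _] := FI _ _ fJ Jy.
      have [IJ|JI] := Ftot _ _ fI fJ.
        by exists J => //; apply: JD => //; apply: IJ.
      by exists I => //; apply: ID => //; apply: JI.
    + move=> a x _ [I fI Ix]; exists I => //.
      by have [[_ _ _ IM] _ _] := FI _ _ fI Ix; apply: IM.
  - by exists I0 => //; have [] := FI _ _ FI0 I0x0.
  - by move=> [I fI I1]; have [] := FI _ _ fI I1.
case: QM => [M0|[idM Mr M1]].
  (* The empty set is not maximal, as it lies properly below [principal r]. *)
  exfalso; apply: (Mmax (principal r)) Qr; rewrite M0 properEneq; split=> //.
  by apply/eqP => e; have := principal_id r; rewrite -e.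
exists M => //; split=> //; first by move=> MT; apply: M1; rewrite MT.
move=> I idI MI; have [I1|I1] := pselect (I 1).
  by right; apply: ideal_with_one.
left; apply: contrapT => IM; apply: (Mmax I).
  by rewrite properEneq; split=> //; apply/eqP => e; apply: IM.
by right; split=> //; apply: MI.
Qed.

Lemma local_nonunit p r : discrete_valuation_ring R ->
  maximal_ideal (principal p) -> r \isn't a GRing.unit -> principal p r.
Proof.
move=> [_ [M [_ _ Muniq]]] pmax /nonunit_in_maximal_ideal[M' M'max M'r].
by rewrite (Muniq _ pmax) -(Muniq _ M'max).
Qed.

Lemma maximal_ideal_nonunit p r :
  maximal_ideal (principal p) -> principal p r -> r \isn't a GRing.unit.
Proof.
move=> [idp pT _] pr; apply/negP => rU; apply: pT.
apply: ideal_with_one => //; have [_ _ _ pM] := idp.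
by rewrite -(mulVr rU); apply: pM.
Qed.

(** If the sum were a nonunit, it would lie in [principal p], and then so would [u]. *)
Lemma unit_add_multiple p u t : discrete_valuation_ring R ->
  maximal_ideal (principal p) ->
  u \is a GRing.unit -> u + t * p \is a GRing.unit.
Proof.
move=> Rdvr pmax uU; apply: contraT => /(local_nonunit Rdvr pmax) /principalP.
move=> [s e]; move: uU; apply: contraLR => _.
apply: (maximal_ideal_nonunit pmax); apply/principalP; exists (s - t).
by rewrite mulrBl -e addrK.
Qed.

End LocalRing.

(** * Entrywise calculus of two-by-two matrices *)

Lemma tofrac_inj (R : idomainType) : injective (@tofrac R).
Proof. by move=> x y /eqP; rewrite tofrac_eq => /eqP. Qed.

Lemma mx2_tofrac_inj (R : idomainType) (a b c d a' b' c' d' : R) :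
  mx2 a%:F b%:F c%:F d%:F = mx2 a'%:F b'%:F c'%:F d'%:F ->
  [/\ a = a', b = b', c = c' & d = d'].
Proof.
move=> /matrixP e.
by split; apply: tofrac_inj; [have := e 0 0|have := e 0 1|have := e 1 0|have := e 1 1];
  rewrite !mxE.
Qed.

Lemma scalar_mx2 (T : nzRingType) (a : T) : a%:M = mx2 a 0 0 a.
Proof.
by apply/matrixP => i j; rewrite !mxE; case: i => [[|[|//]] ?];
  case: j => [[|[|//]] ?]; rewrite /= ?mulr1n ?mulr0n.
Qed.

Lemma addmx2 (T : nzRingType) (a b c d a' b' c' d' : T) :
  mx2 a b c d + mx2 a' b' c' d' = mx2 (a + a') (b + b') (c + c') (d + d').
Proof. by apply/matrixP => i j; rewrite !mxE; case: ifP; case: ifP. Qed.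

Lemma scalemx2 (T : nzRingType) (k a b c d : T) :
  k *: mx2 a b c d = mx2 (k * a) (k * b) (k * c) (k * d).
Proof. by apply/matrixP => i j; rewrite !mxE; case: ifP; case: ifP. Qed.

Lemma adj_mx2 (T : comNzRingType) (a b c d : T) :
  \adj (mx2 a b c d) = mx2 d (- b) (- c) a.
Proof.
apply/matrixP => i j; rewrite !mxE /cofactor det_mx11 !mxE.
by case: i => [[|[|//]] ?]; case: j => [[|[|//]] ?];
  rewrite /= ?expr0 ?expr1 ?expr2 ?mul1r ?mulN1r ?opprK ?mul1r.
Qed.

(** * Closure properties, determinants and reduced norms in the order *)

Section EichlerOrder.
Variables (R : idomainType) (n : nat) (p : R).
Local Notation O := (eichler_order n p).

Lemma eichler_orderD x y : O x -> O y -> O (x + y).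
Proof.
move=> [a [b [c [d ->]]]] [a' [b' [c' [d' ->]]]].
exists (a + a'), (b + b'), (c + c'), (d + d').
by rewrite addmx2 -!rmorphD mulrDr.
Qed.

Lemma eichler_orderZ (r : R) x : O x -> O (r%:F *: x).
Proof.
move=> [a [b [c [d ->]]]]; exists (r * a), (r * b), (r * c), (r * d).
by rewrite scalemx2 -!rmorphM mulrCA.
Qed.

Lemma eichler_order_scalar (r : R) : O (r%:F)%:M.
Proof. by exists r, 0, 0, r; rewrite scalar_mx2 mulr0 rmorph0. Qed.

Lemma eichler_order1 : O 1.
Proof. by have := eichler_order_scalar 1; rewrite rmorph1. Qed.

Lemma eichler_order_adj x : O x -> O (\adj x).
Proof.
move=> [a [b [c [d ->]]]]; exists d, (- b), (- c), a.
by rewrite adj_mx2 mulrN !rmorphN.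
Qed.

(** Both [w] and its inverse in [O] have determinant in [R], so the product of the determinants is
    [1] already in [R]. *)
Lemma units_of_det_unit w : units_of O w ->
  exists2 u, u \is a GRing.unit & \det w = u%:F.
Proof.
move=> [/eichler_order_det[u du] [w' /eichler_order_det[v dv] [e _]]].
exists u => //; apply/unitrP; exists v.
suff uv : u * v = 1 by rewrite mulrC uv.
apply: tofrac_inj; rewrite tofracM tofrac1 -du -dv -det_mulmx.
by rewrite -[w *m w']/(w * w') e det1.
Qed.

(** As [O] contains [1], [r] is one of the generators of the span; each generator is [\det y * r]
    with [\det y] in [R]. *)
Lemma reduced_norm_principal x r : O x -> \det x = r%:F ->
  reduced_norm (left_multiples O x) = [set y%:F | y in principal r].
Proof.
move=> Ox dx; apply/seteqP; split.
  move=> z; apply; split; first split.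
  - by exists 0; rewrite ?rmorph0 //; apply/principalP; exists 0; rewrite mul0r.
  - move=> _ _ [_ [s _ <-] <-] [_ [t _ <-] <-].
    exists ((s + t) * r); first by apply/principalP; exists (s + t).
    by rewrite mulrDl rmorphD.
  - move=> a _ [_ [s _ <-] <-]; exists (a * s * r).
      by apply/principalP; exists (a * s).
    by rewrite -rmorphM mulrA.
  - move=> _ [_ [y /eichler_order_det[s ds] <-] <-].
    exists (s * r); first by apply/principalP; exists s.
    by rewrite -[y * x]/(y *m x) det_mulmx ds dx rmorphM.
move=> _ [_ [s _ <-] <-] N [[_ _ NM] sub].
rewrite rmorphM; apply: NM; apply: sub; exists x => //.
by exists 1; [exact: eichler_order1|rewrite mul1r].
Qed.

End EichlerOrder.

(** * Matrices that are unit scalars modulo [p] act trivially *)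

Section Scalars.
Variables (R : idomainType) (n : nat) (p : R).
Hypothesis R_dvr : discrete_valuation_ring R.
Hypothesis p_max : maximal_ideal (principal p).
Local Notation O := (eichler_order n p).

(** An entry-free form of the candidate kernel, suited to conjugating by a generator [x] and to
    taking adjugates. *)
Definition scalar_mod_p : set 'M[{fraction R}]_2 :=
  [set w | exists a m, [/\ a \is a GRing.unit, O m & w = (a%:F)%:M + p%:F *: m]].

Lemma scalar_mod_pE : scalar_mod_p =
  [set w | exists a b c k1 k2 : R,
     a \is a GRing.unit /\
     w = mx2 (a + k1 * p)%:F (b * p)%:F (c * p ^+ n.+1)%:F (a + k2 * p)%:F].
Proof.
have E a k1 b c k2 : (a%:F)%:M + p%:F *: mx2 k1%:F b%:F (p ^+ n * c)%:F k2%:F =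
    mx2 (a + k1 * p)%:F (b * p)%:F (c * p ^+ n.+1)%:F (a + k2 * p)%:F.
  rewrite scalar_mx2 scalemx2 addmx2 !add0r -!rmorphM -!rmorphD.
  by rewrite exprS; congr mx2; congr tofrac; ring.
apply/seteqP; split=> w.
  by move=> [a [_ [aU [k1 [b [c [k2 ->]]]] ->]]]; exists a, b, c, k1, k2; rewrite E.
move=> [a [b [c [k1 [k2 [aU ->]]]]]].
exists a, (mx2 k1%:F b%:F (p ^+ n * c)%:F k2%:F); split=> //.
by exists k1, b, c, k2.
Qed.

Lemma scalar_mod_p_order w : scalar_mod_p w -> O w.
Proof.
move=> [a [m [_ Om ->]]]; apply: eichler_orderD.
  exact: eichler_order_scalar.
exact: eichler_orderZ.
Qed.

(** The inverse is [\adj w] divided by [\det w]. In size two the adjugate is linear and fixes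
    scalars, so [\adj w] is [a] plus [p] times [\adj m]; modulo [p] the determinant is [a * a], a
    unit. *)
Lemma scalar_mod_p_inv w : scalar_mod_p w ->
  exists w', [/\ scalar_mod_p w', w * w' = 1 & w' * w = 1].
Proof.
move=> Sw; have [a [m [aU Om wE]]] := Sw.
have [u uU du] : exists2 u, u \is a GRing.unit & \det w = u%:F.
  have [k1 [b [c [k2 mE]]]] := Om.
  (* The factor in front of the last [p] is [a] times the trace of [m], plus [p] times its
     determinant. *)
  exists (a * a + (a * k1 + a * k2 + p * k1 * k2 - p * b * (p ^+ n * c)) * p).
    by apply: unit_add_multiple => //; rewrite unitrM aU.
  rewrite wE mE scalar_mx2 scalemx2 addmx2 !add0r det_mx2.
  by rewrite -!rmorphM -!rmorphD -!rmorphM -rmorphB; congr tofrac; ring.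
have uV : (u^-1)%:F * \det w = 1 by rewrite du -rmorphM mulVr ?rmorph1.
exists ((u^-1)%:F *: \adj w); split.
- exists (u^-1 * a), ((u^-1)%:F *: \adj m); split.
  + by rewrite unitrM unitrV uU.
  + by apply: eichler_orderZ; apply: eichler_order_adj.
  have [k1 [b [c [k2 mE]]]] := Om; rewrite wE mE !scalar_mx2.
  rewrite !(scalemx2, addmx2, adj_mx2) !rmorphM !add0r.
  by congr mx2; ring.
- by rewrite -scalerAr -[w * _]/(w *m _) mul_mx_adj -scalemx1 scalerA uV scale1r.
- by rewrite -scalerAl -[_ * w]/(_ *m w) mul_adj_mx -scalemx1 scalerA uV scale1r.
Qed.

Lemma scalar_mod_p_units w : scalar_mod_p w -> units_of O w.
Proof.
move=> Sw; split; first exact: scalar_mod_p_order.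
have [w' [Sw' e1 e2]] := scalar_mod_p_inv Sw.
by exists w' => //; apply: scalar_mod_p_order.
Qed.

Lemma scalar_mod_p_stable w P :
  scalar_mod_p w -> Id n p P -> right_translate P w `<=` P.
Proof.
move=> [a [m [_ Om ->]]] [[x Ox ->] nP] _ [_ [y Oy <-] <-].
have [r dx] := eichler_order_det Ox.
(* [p] lies in the reduced norm of [O x], which is [R r]. *)
have [v pE] : exists v, p = v * r.
  have : [set z%:F | z in principal p] p%:F by exists p => //; apply: principal_id.
  rewrite -nP (reduced_norm_principal Ox dx) => -[_ [v _ <-] /tofrac_inj e].
  by exists v.
(* The factor after [y] is the conjugate of [w] by [x]: the denominator [r] of the inverse of [x] is
   absorbed by [p = v * r]. *)
exists (y * ((a%:F)%:M + v%:F *: (x * m * \adj x))).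
  apply: eichler_orderM => //; apply: eichler_orderD.
    exact: eichler_order_scalar.
  apply: eichler_orderZ; apply: eichler_orderM; first exact: eichler_orderM.
  exact: eichler_order_adj.
rewrite -!mulrA; congr (_ * _); rewrite mulrDl mulrDr; congr (_ + _).
  by rewrite -[_ * x]/(_ *m x) -[x * _]/(x *m _) scalar_mxC.
rewrite -scalerAl -scalerAr -!mulrA -[\adj x * x]/(\adj x *m x) mul_adj_mx dx.
rewrite -scalemx1 -!scalerAr scalerA -rmorphM -pE.
by rewrite -[m * _]/(m *m _) mulmx1.
Qed.

Lemma scalar_mod_p_fix w P :
  scalar_mod_p w -> Id n p P -> right_translate P w = P.
Proof.
move=> Sw IP; apply/seteqP; split; first exact: scalar_mod_p_stable.
(* Translating the inclusion of [P w'] in [P] by [w] gives the reverse inclusion. *)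
have [w' [Sw' e1 e2]] := scalar_mod_p_inv Sw.
have := right_translateS (w := w) (scalar_mod_p_stable Sw' IP).
by rewrite right_translateK.
Qed.

End Scalars.

(** * Principal ideals that differ from the Jacobson radical *)

Section Radical.
Variables (R : idomainType) (n : nat) (p : R).
Hypothesis R_dvr : discrete_valuation_ring R.
Hypothesis p_max : maximal_ideal (principal p).
Hypothesis n_ge1 : (1 <= n)%N.
Local Notation O := (eichler_order n p).

(** Modulo [p], the entry [x i i] is multiplicative on [O], so this set is the kernel of a map onto
    the residue field. These two ideals bound the radical from above. *)
Lemma diagonal_maximal_left_ideal (i : 'I_2) :
  maximal_left_ideal O [set x | O x /\ exists2 r, principal p r & x i i = r%:F].
Proof.
have pn : p ^+ n = p ^+ n.-1 * p by rewrite -exprSr prednK.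
have [_ p0 pD pM] := ideal_principal p.
set M := [set x | _].
have mxii (a b c d : R) : mx2 a%:F b%:F c%:F d%:F i i = (if i == 0 then a else d)%:F.
  by rewrite mxE; case: (i == 0).
have idM : left_ideal O M.
  split.
  - by move=> x [].
  - split; last by exists 0 => //; rewrite mxE rmorph0.
    by have := eichler_order_scalar n p 0; rewrite tofrac0 raddf0.
  - move=> x y [Ox [r pr xr]] [Oy [s ps ys]]; split.
      exact: eichler_orderD.
    by exists (r + s); [exact: pD|rewrite mxE xr ys rmorphD].
  - move=> z x Oz [Ox [r pr xr]]; split; first exact: eichler_orderM.
    case: Oz Ox xr => [a [b [c [d ->]]]] [a' [b' [c' [d' ->]]]].
    rewrite mx2M -!rmorphM -!rmorphD !mxii => /tofrac_inj xr.
    eexists; last by [].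
    (* The two middle goals are the cross terms, where [n >= 1] makes [p ^+ n] a multiple of [p]. *)
    case: ifP xr => _ xr; apply: pD.
    + by rewrite xr; apply: pM.
    + by apply/principalP; exists (b * p ^+ n.-1 * c'); rewrite pn; ring.
    + by apply/principalP; exists (p ^+ n.-1 * c * b'); rewrite pn; ring.
    + by rewrite xr; apply: pM.
split=> //.
  move=> MO; have : M 1 by rewrite MO; exact: eichler_order1.
  move=> [_ [r pr]]; rewrite mxE eqxx mulr1n -(rmorph1 (@tofrac R)) => /tofrac_inj r1.
  have := maximal_ideal_nonunit p_max pr; by rewrite -r1 unitr1.
move=> I [IO I0 ID IM] MI.
have [IsubM|] := pselect (I `<=` M); first by left; apply/seteqP.
move=> /existsNP[y /not_implyP[Iy nMy]]; right.
apply/seteqP; split=> // z Oz.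
have Oii x : O x -> exists r, x i i = r%:F.
  by move=> [a [b [c [d ->]]]]; rewrite mxii; eexists.
have Oy := IO _ Iy; have [r yr] := Oii _ Oy; have [s zs] := Oii _ Oz.
have rU : r \is a GRing.unit.
  apply: contraT => /(local_nonunit R_dvr p_max) pr.
  by exfalso; apply: nMy; split=> //; exists r.
have OZ t := eichler_orderM (eichler_order_scalar n p t) Oy.
(* With the factor [s / r], subtracting this element from [z] clears the entry at [(i, i)], which
   puts the difference in [M]. *)
have Iz0 : I (((s / r)%:F)%:M * y).
  by apply: IM => //; exact: eichler_order_scalar.
rewrite -(subrK (((s / r)%:F)%:M * y) z); apply: ID => //.
apply: MI; split.
  apply: eichler_orderD => //.
  have -> : - (((s / r)%:F)%:M * y) = ((- (s / r))%:F)%:M * y.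
    by rewrite rmorphN raddfN mulNr.
  exact: OZ.
exists 0 => //; rewrite mxE mxE zs -[_ * y]/(_ *m y) mul_scalar_mx mxE yr.
by rewrite -rmorphM divrK // subrr rmorph0.
Qed.

Lemma jacobson_radical_diagonal x (i : 'I_2) :
  jacobson_radical O x -> x i i <> 1.
Proof.
move=> /(_ _ (diagonal_maximal_left_ideal i)) [_ [r pr ->]].
rewrite -(rmorph1 (@tofrac R)) => /tofrac_inj r1.
by have := maximal_ideal_nonunit p_max pr; rewrite r1 unitr1.
Qed.

(** Were [O x] the radical, the radical would contain [x], against the entry [1] on its diagonal. *)
Lemma left_multiples_in_Id' x (i : 'I_2) :
  O x -> \det x = p%:F -> x i i = 1 -> Id' n p (left_multiples O x).
Proof.
move=> Ox dx x1.
have IdP : Id n p (left_multiples O x).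
  by split; [exists x|rewrite (reduced_norm_principal Ox dx)].
rewrite /Id'; case: ifP => // _; split=> // /= e.
apply: (jacobson_radical_diagonal (x := x)) x1; rewrite -e.
by exists 1; [exact: eichler_order1|rewrite mul1r].
Qed.

End Radical.

(** * Determination of the kernel *)

Unset Implicit Arguments.
Set Strict Implicit.

Theorem theorem5p4 (R : idomainType) (p : R) (n : nat)
    (R_dvr : discrete_valuation_ring R)
    (p_max : maximal_ideal (principal p))
    (R_complete : adically_complete p)
    (n_ge1 : (1 <= n)%N) :
  ker_sigma n p =
  [set w | exists a b c k1 k2 : R,
     a \is a GRing.unit /\
     w = mx2 (a + k1 * p)%:F (b * p)%:F (c * p ^+ n.+1)%:F (a + k2 * p)%:F].
Proof.
rewrite -scalar_mod_pE; apply/seteqP; split=> w; last first.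
  move=> Sw; have Uw := scalar_mod_p_units R_dvr p_max Sw.
  exists (exist _ w (mem_set Uw)) => //=; apply/funext => P; apply: val_inj => /=.
  apply: (scalar_mod_p_fix R_dvr p_max Sw).
  by case: P => P /= /set_mem; rewrite /Id'; case: ifP => // _ [].
move=> [[w0 /= Uw0] sw <-] /=; have Uw := set_mem Uw0.
(* Since [x] lies in [O x], the product [x * w0] lies in [O x w0], which is [O x]. *)
have fixw x (i : 'I_2) : eichler_order n p x -> \det x = p%:F -> x i i = 1 ->
    exists2 y, eichler_order n p y & y * x = x * w0.
  move=> Ox dx xi.
  have IP := left_multiples_in_Id' R_dvr p_max n_ge1 Ox dx xi.
  pose P : set_type (Id' n p) :=
    exist (fun P => P \in Id' n p) _ (mem_set IP).
  have /= e := congr1 (fun f => sval (f P)) sw.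
  have : right_translate (left_multiples (eichler_order n p) x) w0 (x * w0).
    exists x => //; exists 1; first exact: eichler_order1.
    by rewrite mul1r.
  by rewrite e.
have [u uU du] := units_of_det_unit Uw.
have [[a [b [c [d wE]]]] _] := Uw; rewrite {}wE in fixw du *.
have pn : p ^+ n = p ^+ n.-1 * p by rewrite -exprSr prednK.
(* For [x = (1 0; 0 p)], the upper right entries of [x w = y x] give [b = y2 * p]. *)
have [b1 bE] : exists b1, b = b1 * p.
  have [|||y [y1 [y2 [y3 [y4 ->]]]]] := fixw (mx2 1%:F 0%:F (p ^+ n * 0)%:F p%:F) 0.
  - by exists 1, 0, 0, p.
  - by rewrite det_mx2 -!rmorphM -rmorphB; congr tofrac; ring.
  - by rewrite mxE rmorph1.
  rewrite !mx2M -!tofracM -!tofracD => /mx2_tofrac_inj[_ e _ _].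
  by exists y2; transitivity (1 * b + 0 * d); [ring|rewrite -e; ring].
(* For [x = (1 1; 0 p)], the top rows give [y1 = a + p ^+ n * c] and [b + d = y1 + y2 * p]; both [b]
   and [p ^+ n] vanish modulo [p]. *)
have [k dE] : exists k, d = a + k * p.
  have [|||y [y1 [y2 [y3 [y4 ->]]]]] := fixw (mx2 1%:F 1%:F (p ^+ n * 0)%:F p%:F) 0.
  - by exists 1, 1, 0, p.
  - by rewrite det_mx2 -!rmorphM -rmorphB; congr tofrac; ring.
  - by rewrite mxE rmorph1.
  rewrite !mx2M -!tofracM -!tofracD => /mx2_tofrac_inj[e1 e2 _ _].
  exists (p ^+ n.-1 * c + y2 - b1).
  have {}e1 : y1 = a + p ^+ n * c.
    by transitivity (y1 * 1 + y2 * (p ^+ n * 0)); [ring|rewrite e1; ring].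
  have {}e2 : b + d = y1 + y2 * p.
    by transitivity (1 * b + 1 * d); [ring|rewrite -e2; ring].
  by rewrite -(addKr b d) e2 e1 bE pn; ring.
(* For [x = (p 0; 0 1)], the lower left entries are compared. Keeping [p ^+ n] on both sides avoids
   a cancellation. *)
have [c1 cE] : exists c1, p ^+ n * c = c1 * p ^+ n.+1.
  have [|||y [y1 [y2 [y3 [y4 ->]]]]] := fixw (mx2 p%:F 0%:F (p ^+ n * 0)%:F 1%:F) 1.
  - by exists p, 0, 0, 1.
  - by rewrite det_mx2 -!rmorphM -rmorphB; congr tofrac; ring.
  - by rewrite mxE rmorph1.
  rewrite !mx2M -!tofracM -!tofracD => /mx2_tofrac_inj[_ _ e _].
  exists y3; transitivity (p ^+ n * 0 * a + 1 * (p ^+ n * c)); first by ring.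
  by rewrite -e exprS; ring.
(* The scalar is the upper left entry itself, hence [k1 = 0]. *)
rewrite scalar_mod_pE; exists a, b1, c1, 0, k; split; last first.
  by rewrite mul0r addr0 -bE -cE -dE.
(* If [a] were a multiple of [p], then, as [b] is one, so would be the determinant [u], which is a
   unit. *)
apply: contraT => /(local_nonunit R_dvr p_max) /principalP[t aE].
move: du; rewrite det_mx2 -!rmorphM -rmorphB => /tofrac_inj uE.
suff /(maximal_ideal_nonunit p_max) : principal p u by rewrite uU.
by apply/principalP; exists (t * d - b1 * (p ^+ n * c)); rewrite -uE aE bE; ring.
Qed.
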